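(* Let $\mathcal B'\subset\mathcal B$ be finite sets and let $\vec{\mathcal H}'$ be a finite sequence of conjugacy classes of finitely generated subgroups of $F(\mathcal B')$. Then $\vec{\mathcal H}'$ is a Gersten representative with respect to $\mathcal B'$ (i.e. of minimal complexity in its $\mathrm{Aut}(F(\mathcal B'))$-orbit, computed with $\mathcal B'$-graphs) if and only if $\vec{\mathcal H}'$, regarded as a sequence of conjugacy classes of subgroups of $F(\mathcal B)\supset F(\mathcal B')$, is a Gersten representative with respect to $\mathcal B$.
   Context: $F(\mathcal B)$ is the free group on $\mathcal B$, identified with $\pi_1$ of the rose $R_{\mathcal B}$. For a conjugacy class $[[H]]$ of a finitely generated subgroup, $\Sigma([[H]])$ is the core of the covering graph of $R_{\mathcal B}$ corresponding to $H$, a finite graph with oriented edges labeled in $\mathcal B^{\pm1}$ (empty if $H=1$). The complexity $c(\vec{\mathcal H})$ of a sequence is the total number of edges of the graphs $\Sigma(\mathcal H_i)$; automorphisms act componentwise. A sequence is a Gersten representative (with respect to $\mathcal B$) if its complexity is minimal among all $\alpha\vec{\mathcal H}$, $\alpha\in\mathrm{Aut}(F(\mathcal B))$. *)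

(* Defs.v *)
(* Free groups as reduced words; Stallings core graphs
   described through their (positively oriented) edges. *)
From mathcomp Require Import all_boot.
Set Implicit Arguments. Unset Strict Implicit. Unset Printing Implicit Defensive.

Section FreeGroup.
Variable T : finType.

(* a letter (a, true) is a, (a, false) is a^-1 *)
Definition letter := (T * bool)%type.
Definition word := seq letter.

Definition inv_letter (x : letter) : letter := (x.1, ~~ x.2).

Fixpoint reduced (w : word) : bool :=
  match w with
  | x :: ((y :: _) as w') => (y != inv_letter x) && reduced w'
  | _ => true
  end.

Definition push (x : letter) (s : word) : word :=
  match s with
  | y :: s' => if y == inv_letter x then s' else x :: s
  | [::] => [:: x]
  end.

Fixpoint reduce (w : word) : word :=
  match w with
  | [::] => [::]
  | x :: w' => push x (reduce w')
  end.

(* group operations in the free group F(T), elements = reduced words *)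
Definition mulw (u v : word) : word := reduce (u ++ v).
Definition invw (u : word) : word := rev (map inv_letter u).

Definition cyc_reduced (w : word) : bool :=
  reduced w && (if w is x :: w' then last x w' != inv_letter x else true).

Definition in_F (S : {set T}) (w : word) : bool := all (fun x => x.1 \in S) w.

Definition in_sub (gens : seq word) (x : word) : Prop :=
  exists s : seq word,
    all (fun g => (g \in gens) || (invw g \in gens)) s /\ x = reduce (flatten s).

(* (w, b) names the edge Hw --b--> Hwb of the covering graph of R_S
   corresponding to H = <gens> (w in F(S)); it lies in the core iff it is
   traversed (positively, as first edge) by a closed cyclically reduced path
   starting at Hw, labelled r (nonempty, cyclically reduced, w r w^-1 in H). *)
Definition core_edge (S : {set T}) (gens : seq word) (w : word) (b : T) : Prop :=
  [/\ b \in S, reduced w, in_F S w &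
      exists r : word, [/\ cyc_reduced r, in_F S r, head (b, false) r = (b, true)
                          & in_sub gens (mulw (mulw w r) (invw w))]].

(* two edge names denote the same edge: same label and same coset Hw = Hw' *)
Definition edge_equiv (gens : seq word) (e e' : word * T) : Prop :=
  e.2 = e'.2 /\ in_sub gens (mulw e'.1 (invw e.1)).

Definition core_size (S : {set T}) (gens : seq word) (n : nat) : Prop :=
  exists es : seq (word * T),
    [/\ size es = n,
        (forall e, e \in es -> core_edge S gens e.1 e.2),
        uniq es,
        (forall e e', e \in es -> e' \in es -> edge_equiv gens e e' -> e = e')
     &  (forall w b, core_edge S gens w b -> exists2 e, e \in es & edge_equiv gens e (w, b))].

Definition seq_size (S : {set T}) (Hs : seq (seq word)) (n : nat) : Prop :=
  exists ns : seq nat,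
    [/\ size ns = size Hs,
        (forall i, i < size Hs -> core_size S (nth [::] Hs i) (nth 0 ns i))
      & n = sumn ns].

Definition is_aut (S : {set T}) (f : word -> word) : Prop :=
  [/\ (forall u, reduced u -> in_F S u -> reduced (f u) && in_F S (f u)),
      (forall u v, reduced u -> in_F S u -> reduced v -> in_F S v ->
          f (mulw u v) = mulw (f u) (f v)),
      (forall u v, reduced u -> in_F S u -> reduced v -> in_F S v ->
          f u = f v -> u = v)
    & (forall v, reduced v -> in_F S v ->
          exists2 u, reduced u && in_F S u & f u = v)].

Definition aut_img (f : word -> word) (Hs : seq (seq word)) : seq (seq word) :=
  map (map (fun g => f (reduce g))) Hs.

Definition gersten (S : {set T}) (Hs : seq (seq word)) : Prop :=
  exists n, seq_size S Hs n /\
    forall f, is_aut S f -> forall m, seq_size S (aut_img f Hs) m -> n <= m.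

End FreeGroup.

(* Main.v *)
(** The core graph of a subgroup of [F(B')] only uses edges labelled in [B'],
    so the complexity of the sequence is the same over [B'] and over [T], and an
    automorphism of [F(B')] extends by the identity; this gives one direction.
    For the other one, let [alpha] be an automorphism of [F(T)] and
    [A = alpha F(B')]. Nielsen reduction provides an automorphism [beta] of
    [F(B')] such that the basis [psi b], [psi = alpha \o beta], of [A] is dual to
    the edges outside a shortlex spanning tree of the covering graph of [A]:
    [psi b = t b * c b * (t b^-1)^-1], and the letters [c b] survive in every
    reduced product. Collapsing the tree sends the core of [alpha H] onto the
    core of [beta^-1 H]; concretely, the edge [(w, b)] of the latter injects to
    the edge [(psi w * t b, c b)] of the former, so [beta^-1] does not have
    larger complexity than [alpha]. *)
Require Import Defs.
From Stdlib Require Import Classical.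
From mathcomp Require Import all_boot zify.

Set Implicit Arguments.
Unset Strict Implicit.
Unset Printing Implicit Defensive.

(** * Free reduction, inverses and reduced words *)

Section FreeReduction.
Variable T : finType.
Implicit Types (x y z : letter T) (u v w p q r : word T) (S : {set T}).

(** As a relation, it turns reduced words into [sorted] sequences and cyclically reduced words into
    [cycle]s, so that lemmas on paths and rotations apply. *)
Definition noncancel : rel (letter T) := fun x y => y != inv_letter x.

Lemma inv_letterK : involutive (@inv_letter T).
Proof. by case=> a b; rewrite /inv_letter /= negbK. Qed.

Lemma inv_letter_neq x : inv_letter x != x.
Proof. by case: x => a []; rewrite /inv_letter xpair_eqE eqxx. Qed.

Lemma eq_inv_letter x y : (inv_letter x == y) = (x == inv_letter y).
Proof. by rewrite -(inj_eq (inv_inj inv_letterK)) inv_letterK. Qed.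

Lemma noncancel_inv x y : noncancel (inv_letter y) (inv_letter x) = noncancel x y.
Proof. by rewrite /noncancel inv_letterK eq_inv_letter eq_sym eq_inv_letter eq_sym eq_inv_letter. Qed.

Lemma reducedE w : reduced w = sorted noncancel w.
Proof. by elim: w => // x [|y w] //= ->. Qed.

Lemma reduced_cons x w : reduced (x :: w) = path noncancel x w.
Proof. exact: reducedE. Qed.

Lemma cyc_reducedE w : cyc_reduced w = cycle noncancel w.
Proof.
case: w => // x w; rewrite /cyc_reduced reduced_cons /= rcons_path; congr (_ && _).
by rewrite /noncancel [x == _]eq_sym eq_inv_letter.
Qed.

Lemma reduced_catl u v : reduced (u ++ v) -> reduced u.
Proof. by rewrite !reducedE; case: u => // x u /=; rewrite cat_path => /andP[]. Qed.

Lemma reduced_catr u v : reduced (u ++ v) -> reduced v.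
Proof.
elim: u => // x u IH; rewrite cat_cons => h; apply: IH.
by move: h; rewrite !reducedE => /path_sorted.
Qed.

Lemma reduced_cat_cons u x v :
  reduced (u ++ x :: v) = reduced (rcons u x) && reduced (x :: v).
Proof.
rewrite !reducedE; case: u => [|y u] //=.
by rewrite cat_path rcons_path /= andbA.
Qed.

Lemma reduced_push x w : reduced w -> reduced (push x w).
Proof.
case: w => [|y w] //= h; case: ifP => e; last by rewrite /= e.
by case: w h => //= z w /andP[].
Qed.

Lemma reduced_reduce w : reduced (reduce w).
Proof. by elim: w => //= x w; apply: reduced_push. Qed.

Lemma reduce_id w : reduced w -> reduce w = w.
Proof.
elim: w => // x w IH; rewrite reducedE => h /=.
rewrite IH ?reducedE ?(path_sorted h) //.
by case: w h {IH} => //= y w /andP[/negbTE ->].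
Qed.

Lemma reduce_idem w : reduce (reduce w) = reduce w.
Proof. exact/reduce_id/reduced_reduce. Qed.

Lemma push_inv x w : reduced w -> push x (push (inv_letter x) w) = w.
Proof.
case: w => [|y w] /=; first by rewrite eqxx.
rewrite inv_letterK; case: eqP => [->|_] h; last by rewrite /= eqxx.
by case: w h => //= z w /andP[/negbTE ->].
Qed.

Lemma reduce_catr u v : reduce (u ++ reduce v) = reduce (u ++ v).
Proof. by elim: u => [|x u /= ->] //; rewrite reduce_idem. Qed.

(** Words act on reduced words by [push], and a letter and its inverse act inversely to each other
    ([push_inv]); a cancellation inside [u] therefore leaves the action of [u] unchanged. *)
Lemma reduce_catl u v : reduce (reduce u ++ v) = reduce (u ++ v).
Proof.
elim: u => //= x u <-; case: (reduce u) => //= y w; case: eqP => // ->.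
by rewrite push_inv ?reduced_reduce.
Qed.

Lemma reduce_congr u u' v v' :
  reduce u = reduce u' -> reduce v = reduce v' -> reduce (u ++ v) = reduce (u' ++ v').
Proof. by move=> e1 e2; rewrite -reduce_catl -reduce_catr e1 e2 reduce_catr reduce_catl. Qed.

Lemma invw_cons x w : invw (x :: w) = rcons (invw w) (inv_letter x).
Proof. by rewrite /invw /= rev_cons. Qed.

Lemma invw_cat u v : invw (u ++ v) = invw v ++ invw u.
Proof. by rewrite /invw map_cat rev_cat. Qed.

Lemma invw_rcons w x : invw (rcons w x) = inv_letter x :: invw w.
Proof. by rewrite -cats1 invw_cat. Qed.

Lemma invwK : involutive (@invw T).
Proof. by move=> w; rewrite /invw map_rev revK mapK //; apply: inv_letterK. Qed.

Lemma size_invw w : size (invw w) = size w.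
Proof. by rewrite size_rev size_map. Qed.

Lemma in_F_cat S u v : in_F S (u ++ v) = in_F S u && in_F S v.
Proof. exact: all_cat. Qed.

Lemma in_F_invw S w : in_F S (invw w) = in_F S w.
Proof. by rewrite /in_F all_rev all_map. Qed.

Lemma in_F_reduce S w : in_F S w -> in_F S (reduce w).
Proof.
elim: w => //= x w IH /andP[hx /IH]; case: (reduce w) => [|y v] /=; first by rewrite hx.
by case: eqP => [_ /andP[]|_ h] //=; rewrite hx.
Qed.

Lemma in_FT w : in_F [set: T] w.
Proof. by apply/allP => x _; rewrite inE. Qed.

Lemma reduced_invw w : reduced (invw w) = reduced w.
Proof.
elim: w => // x w IH; rewrite invw_cons !reducedE.
case: w IH => // y w IH; rewrite invw_cons -!cats1 -catA /=.
move: (reduced_cat_cons (invw w) (inv_letter y) [:: inv_letter x]).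
rewrite !reducedE => ->; rewrite -invw_cons -reducedE IH reducedE /= andbT andbC.
by rewrite noncancel_inv.
Qed.

Lemma reduce_invr w : reduce (w ++ invw w) = [::].
Proof.
elim: w => //= x w IH; rewrite invw_cons -cats1 catA -reduce_catl IH /=.
by rewrite eqxx.
Qed.

Lemma reduce_invl w : reduce (invw w ++ w) = [::].
Proof. by rewrite -{2}(invwK w) reduce_invr. Qed.

Lemma reduce_cancelr u v : reduce (u ++ invw u ++ v) = reduce v.
Proof. by rewrite catA -reduce_catl reduce_invr. Qed.

Lemma reduce_cancell u v : reduce (invw u ++ u ++ v) = reduce v.
Proof. by rewrite catA -reduce_catl reduce_invl. Qed.

Lemma reduce_catIl u v w : reduce (u ++ v) = reduce (u ++ w) -> reduce v = reduce w.
Proof.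
by move=> h; rewrite -(reduce_cancell u v) -reduce_catr h reduce_catr reduce_cancell.
Qed.

Lemma reduce_catIr u v w : reduce (v ++ u) = reduce (w ++ u) -> reduce v = reduce w.
Proof.
move=> h; have e w1 : reduce ((w1 ++ u) ++ invw u) = reduce w1.
  by rewrite -catA -reduce_catr reduce_invr cats0.
by rewrite -e -reduce_catl h reduce_catl e.
Qed.

Lemma reduce_invw w : reduce (invw w) = invw (reduce w).
Proof.
rewrite -[RHS]reduce_id ?reduced_invw ?reduced_reduce //.
apply: (@reduce_catIl w); rewrite reduce_invr.
by rewrite -reduce_catl reduce_invr.
Qed.

Lemma size_reduce w : size (reduce w) <= size w.
Proof.
elim: w => //= x w; case: (reduce w) => //= y v; case: ifP => //= _ h.
by lia.
Qed.

Lemma reduce_size_id w : size (reduce w) = size w -> reduce w = w.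
Proof.
elim: w => //= x w; have := size_reduce w; case: (reduce w) => [|y v] /= h IH.
  by move=> [e]; rewrite -IH //.
by case: ifP => _ /= e; [lia | rewrite IH //; case: e].
Qed.

Lemma eq_reduced u v : reduced u -> reduced v -> reduce u = reduce v -> u = v.
Proof. by move=> hu hv; rewrite !reduce_id. Qed.

(** Induction on [w] from its end: as long as the last letter [x] of [w] cancels against an end of
    [r], it is absorbed by a rotation of [r], which keeps [r] cyclically reduced with the same
    letters. Once nothing cancels, [w ++ r ++ invw w] is reduced and its letters can be read off. *)
Lemma conj_in_F S w r : r != [::] -> reduced w -> cyc_reduced r ->
  in_F S (reduce (w ++ r ++ invw w)) -> in_F S w && in_F S r.
Proof.
elim/last_ind: w r => [|w x IH] r r0 hw hr.
  by rewrite cats0 /= reduce_id //; case/andP: hr.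
have hw0 : reduced w by move: hw; rewrite -cats1 => /reduced_catl.
case: r => [|y r] // in r0 hr *.
rewrite !invw_rcons => h.
case: (last y r =P x) => [er|nr].
  rewrite lastI er in hr h *; set r' := belast _ _ in hr h *.
  have hr' : cyc_reduced (x :: r').
    by rewrite cyc_reducedE -(rot_cycle 1) rot1_cons -cyc_reducedE.
  suff /andP[h1 h2]: in_F S w && in_F S (x :: r').
    by move: h2; rewrite -!cats1 !in_F_cat h1 /= => /andP[-> ->].
  apply: IH => //; move: h; rewrite -!cats1 -!catA /=.
  set a := reduce _; set b := reduce _; suff -> : a = b by [].
  apply: reduce_congr => //=; congr (push _ _); apply: reduce_congr => //.
  exact: (reduce_cancelr [:: x]).
case: (y =P inv_letter x) => [ey|ny].
  have hr' : cyc_reduced (rcons r y) by rewrite cyc_reducedE -rot1_cons rot_cycle -cyc_reducedE.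
  suff /andP[h1 h2]: in_F S w && in_F S (rcons r y).
    by move: h2; rewrite -!cats1 !in_F_cat h1 /= ey /= => /and3P[-> -> _].
  apply: IH => //; first by case: (r).
  move: h; rewrite -!cats1 -!catA /= ey.
  set a := reduce _; set b := reduce _; suff -> : a = b by [].
  apply: reduce_congr => //; exact: (reduce_cancelr [:: x]).
move: h; rewrite reduce_id; first by rewrite !in_F_cat => /and3P[-> ->].
rewrite -[rcons w x]cats1 -catA cat1s reduced_cat_cons hw andTb.
rewrite reduced_cons /= cat_path /=.
move: (hw); rewrite -reduced_invw invw_rcons reduced_cons => ->.
move: hr; rewrite /cyc_reduced reduced_cons => /andP[-> _].
rewrite andbT /= /noncancel; apply/andP; split; first exact/eqP.
by rewrite eq_sym; apply/eqP => /(inv_inj inv_letterK).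
Qed.
End FreeReduction.

(** * Generated subgroups, change of alphabet, homomorphisms *)

Section Subgroups.
Variable T : finType.
Implicit Types (x y z : letter T) (u v w p q r : word T) (S : {set T}).
Implicit Types (H : seq (word T)) (b : T).

Lemma mulwE u v w : mulw (mulw u v) w = reduce (u ++ v ++ w).
Proof. by rewrite /mulw reduce_catl catA. Qed.

Lemma in_sub_reduced H u : in_sub H u -> reduced u.
Proof. by case=> s [_ ->]; apply: reduced_reduce. Qed.

Lemma in_sub_mul H u v : in_sub H u -> in_sub H v -> in_sub H (reduce (u ++ v)).
Proof.
move=> [s [hs ->]] [s' [hs' ->]]; exists (s ++ s'); split; first by rewrite all_cat hs.
by rewrite reduce_catl reduce_catr flatten_cat.
Qed.

Lemma invw_flatten (s : seq (word T)) : invw (flatten s) = flatten (rev (map (@invw T) s)).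
Proof.
by elim: s => // u s IH; rewrite /= invw_cat IH rev_cons flatten_rcons.
Qed.

Lemma in_sub_inv H u : in_sub H u -> in_sub H (invw u).
Proof.
move=> [s [hs ->]]; exists (rev (map (@invw T) s)); split; last first.
  by rewrite -invw_flatten reduce_invw.
rewrite all_rev all_map; apply: sub_all hs => g /=.
by rewrite invwK orbC.
Qed.

Lemma in_sub_in_F S H u : (forall g, g \in H -> in_F S g) -> in_sub H u -> in_F S u.
Proof.
move=> hH [s [hs ->]]; apply: in_F_reduce; elim: s hs => //= g s IH /andP[hg /IH hs].
rewrite in_F_cat hs andbT; case/orP: hg => /hH //.
by rewrite in_F_invw.
Qed.

(** The conjugate $w r w^{-1}$ of a witnessing loop lies in a subgroup of $F(S)$, so [conj_in_F]
    puts [w] and [r] themselves over [S]. *)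
Lemma core_edge_setT S H w b : (forall g, g \in H -> in_F S g) ->
  core_edge S H w b <-> core_edge [set: T] H w b.
Proof.
move=> hH; split=> -[hb hw hFw [r [hr hFr er hwr]]].
  by split; rewrite ?inE ?in_FT //; exists r; rewrite in_FT.
have r0 : r != [::] by case: (r) er.
have /andP[hw1 hr1] : in_F S w && in_F S r.
  by apply: conj_in_F => //; rewrite -mulwE; apply: in_sub_in_F hwr.
split=> //; last by exists r.
by case: r r0 hr1 er {hr hFr hwr} => //= x r _ /andP[hx _] ex; move: hx; rewrite ex.
Qed.

Lemma core_size_setT S H n : (forall g, g \in H -> in_F S g) ->
  core_size S H n <-> core_size [set: T] H n.
Proof.
move=> hH; split=> -[es [h1 h2 h3 h4 h5]]; exists es; split=> //.
- by move=> e /h2 /(core_edge_setT _ _ hH).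
- by move=> w b /(core_edge_setT _ _ hH); apply: h5.
- by move=> e /h2 /(core_edge_setT _ _ hH).
- by move=> w b /(core_edge_setT _ _ hH); apply: h5.
Qed.

Lemma seq_size_setT S (Hs : seq (seq (word T))) n :
  (forall H, H \in Hs -> forall g, g \in H -> in_F S g) ->
  seq_size S Hs n <-> seq_size [set: T] Hs n.
Proof.
move=> hH; split=> -[ns [h1 h2 h3]]; exists ns; split=> // i hi.
- by apply/(@core_size_setT S); [apply/hH/mem_nth | apply: h2].
- by apply/(@core_size_setT S); [apply/hH/mem_nth | apply: h2].
Qed.

(** The target is the free group on all of [T], so that $\alpha \circ \beta$ restricted to $F(S)$
    qualifies. Values outside the reduced words over [S] are unconstrained, hence the form
    [f (reduce u)] in the lemmas below. *)
Definition is_hom S (f : word T -> word T) : Prop :=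
  (forall u, reduced u -> in_F S u -> reduced (f u)) /\
  (forall u v, reduced u -> in_F S u -> reduced v -> in_F S v ->
     f (mulw u v) = mulw (f u) (f v)).

Lemma aut_hom S f : is_aut S f -> is_hom S f.
Proof. by case=> h1 h2 _ _; split=> // u hu hF; case/andP: (h1 u hu hF). Qed.

Lemma aut_in_F S f u : is_aut S f -> in_F S u -> in_F S (f (reduce u)).
Proof.
by case=> h1 _ _ _ hu; case/andP: (h1 _ (reduced_reduce u) (in_F_reduce hu)).
Qed.

Section Hom.
Variables (S : {set T}) (f : word T -> word T).
Hypothesis hf : is_hom S f.

Lemma hom_reduced u : in_F S u -> reduced (f (reduce u)).
Proof. by move=> hu; apply: hf.1; rewrite ?reduced_reduce ?in_F_reduce. Qed.

Lemma hom_cat u v : in_F S u -> in_F S v ->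
  f (reduce (u ++ v)) = reduce (f (reduce u) ++ f (reduce v)).
Proof.
move=> hu hv; rewrite -/(mulw (f _) (f _)) -hf.2 ?reduced_reduce ?in_F_reduce //.
by rewrite /mulw reduce_catl reduce_catr.
Qed.

Lemma hom1 : f [::] = [::].
Proof.
have r1 : reduced (f [::]) by apply: hf.1.
have h : reduce (f [::] ++ f [::]) = reduce (f [::] ++ [::]).
  by rewrite -(@hom_cat [::] [::]) //= cats0 reduce_id.
by move/reduce_catIl: h; rewrite /= reduce_id.
Qed.

Lemma hom_inv u : in_F S u -> f (reduce (invw u)) = invw (f (reduce u)).
Proof.
move=> hu; have hv : in_F S (invw u) by rewrite in_F_invw.
apply: eq_reduced; rewrite ?reduced_invw ?hom_reduced //.
by apply: (@reduce_catIl T (f (reduce u))); rewrite -hom_cat // !reduce_invr hom1.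
Qed.

Lemma hom_flatten (s : seq (word T)) : all (in_F S) s ->
  f (reduce (flatten s)) = reduce (flatten (map (f \o @reduce T) s)).
Proof.
elim: s => [|u s IH] /=; first by rewrite hom1.
move=> /andP[hu hs]; rewrite hom_cat ?IH ?reduce_catr //.
by elim: s hs {IH} => //= v s IH /andP[hv /IH]; rewrite in_F_cat hv.
Qed.

Lemma in_sub_hom H v : (forall g, g \in H -> in_F S g) ->
  in_sub (map (fun g => f (reduce g)) H) v <-> exists2 u, in_sub H u & v = f u.
Proof.
move=> hH.
have hF s : all (fun g => (g \in H) || (invw g \in H)) s -> all (in_F S) s.
  by apply: sub_all => g /orP[/hH|/hH] //; rewrite in_F_invw.
split=> [[s [hs ->]]|[u [s [hs ->]] ->]].
- suff [s' hs' ->] : exists2 s', all (fun g => (g \in H) || (invw g \in H)) s' &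
      s = map (f \o @reduce T) s'.
    exists (reduce (flatten s')); first by exists s'.
    by rewrite hom_flatten ?hF.
  elim: s hs => [|g s IH] /=; first by exists [::].
  move=> /andP[hg /IH[s' hs' ->]]; case/orP: hg => /mapP[g' hg' eg].
    by exists (g' :: s') => /=; rewrite ?hg' ?eg.
  exists (invw g' :: s') => /=; first by rewrite invwK hg' orbT.
  by rewrite hom_inv ?hH // -eg invwK.
- exists (map (f \o @reduce T) s); split; last by rewrite hom_flatten ?hF.
  apply/allP => g /mapP[g' /(allP hs) hg' ->] /=; case/orP: hg' => hg'.
    by rewrite map_f.
  have hF' : in_F S g' by rewrite -in_F_invw hH.
  by rewrite -hom_inv // (map_f (fun g => f (reduce g)) hg') orbT.
Qed.

Lemma hom_letters w : in_F S w ->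
  f (reduce w) = reduce (flatten (map (fun x => f [:: x]) w)).
Proof.
move=> hw; have e : flatten (map (fun x => [:: x]) w) = w by elim: (w) => //= x v ->.
by rewrite -{1}e hom_flatten -?map_comp // all_map; apply: sub_all hw => x /= ->.
Qed.
End Hom.

Lemma is_hom_comp S f g : is_aut S g -> is_hom [set: T] f -> is_hom S (f \o g).
Proof.
move=> hg hf; have [h1 h2] := aut_hom hg.
split=> [u hu hF|u v hu hFu hv hFv] /=.
  by apply: hf.1; rewrite ?h1 ?in_FT.
by rewrite h2 // hf.2 ?in_FT ?h1.
Qed.

Lemma is_aut_comp S f g : is_aut S f -> is_aut S g -> is_aut S (f \o g).
Proof.
case=> f1 f2 f3 f4 [g1 g2 g3 g4].
split=> [u hu hF|u v hu hFu hv hFv|u v hu hFu hv hFv|v hv hF] /=.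
- by case/andP: (g1 u hu hF); apply: f1.
- by case/andP: (g1 u hu hFu) (g1 v hv hFv) => ? ? /andP[? ?]; rewrite g2 // f2.
- by case/andP: (g1 u hu hFu) (g1 v hv hFv) => ? ? /andP[? ?] /f3 e; apply: g3 => //; apply: e.
- have [w /andP[hw hFw] <-] := f4 v hv hF; have [u hu <-] := g4 w hw hFw.
  by exists u.
Qed.

Lemma aut_inverse S f : is_aut S f ->
  exists2 g, is_aut S g & forall u, in_F S u ->
    f (g (reduce u)) = reduce u /\ g (f (reduce u)) = reduce u.
Proof.
move=> hf; have [f1 f2 f3 f4] := hf.
(* The implication makes the condition satisfiable for every [v], with [v] itself as default, so
   that [xchoose] yields a total preimage function. *)
have ex v : exists u, reduced v && in_F S v ==> [&& reduced u, in_F S u & f u == v].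
  case: (boolP (reduced v && in_F S v)) => [/andP[hv hF]|]; last by exists v.
  by have [u /andP[hu hFu] <-] := f4 v hv hF; exists u; rewrite hu hFu eqxx.
pose g v := xchoose (ex v).
have gP v : reduced v -> in_F S v -> [/\ reduced (g v), in_F S (g v) & f (g v) = v].
  move=> hv hF; have := xchooseP (ex v); rewrite -/(g v); move: (g v) => u /=; rewrite hv hF.
  by case/and3P=> ? ? /eqP.
have gf u : reduced u -> in_F S u -> g (f u) = u.
  move=> hu hF; have /andP[h1 h2] := f1 u hu hF.
  by have [h3 h4 h5] := gP _ h1 h2; apply: f3.
exists g; last first.
  move=> u hu; have h1 := reduced_reduce u; have h2 := in_F_reduce hu.
  by have [_ _ ->] := gP _ h1 h2; rewrite gf.
split=> [u hu hF|u v hu hFu hv hFv|u v hu hFu hv hFv e|v hv hF].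
- by have [-> ->] := gP _ hu hF.
- have [a1 a2 a3] := gP _ hu hFu; have [b1 b2 b3] := gP _ hv hFv.
  rewrite -[in LHS]a3 -[in LHS]b3 -f2 // gf // /mulw ?reduced_reduce //.
  by rewrite in_F_reduce // in_F_cat a2.
- by have [_ _ <-] := gP _ hu hFu; have [_ _ <-] := gP _ hv hFv; rewrite e.
- by exists (f v); [apply: f1 | apply: gf].
Qed.

(** * Endomorphisms given on letters, and extension of automorphisms *)

Definition ext (g : letter T -> word T) (w : word T) : word T :=
  reduce (flatten (map g w)).

Section Ext.
Variable g : letter T -> word T.
Hypothesis gV : forall x, g (inv_letter x) = invw (g x).

Lemma ext_cat u v : ext g (u ++ v) = reduce (ext g u ++ ext g v).
Proof. by rewrite /ext map_cat flatten_cat reduce_catl reduce_catr. Qed.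

(** By [gV] the images of two cancelling letters cancel, so [ext g] depends only on the group
    element that a word represents. *)
Lemma ext_reduce w : ext g (reduce w) = ext g w.
Proof.
elim: w => // x w IH; rewrite -cat1s ext_cat -IH /=.
case: (reduce w) => [|y v] /=; first by rewrite /ext /= cats0 cats0 reduce_idem.
case: eqP => [->|_]; last by rewrite -ext_cat.
rewrite -[inv_letter x :: v]cat1s ext_cat reduce_catr.
have -> : ext g [:: inv_letter x] = invw (ext g [:: x]) by rewrite /ext /= !cats0 gV reduce_invw.
by rewrite reduce_cancelr reduce_idem.
Qed.
End Ext.

Lemma ext_aut S g h :
  (forall x, g (inv_letter x) = invw (g x)) ->
  (forall x, h (inv_letter x) = invw (h x)) ->
  (forall x, x.1 \in S -> [/\ in_F S (g x), in_F S (h x),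
     ext g (h x) = [:: x] & ext h (g x) = [:: x]]) ->
  is_aut S (ext g).
Proof.
move=> gV hV gh.
have FF (k : letter T -> word T) w : (forall x, x.1 \in S -> in_F S (k x)) ->
    in_F S w -> in_F S (ext k w).
  move=> hk hw; apply: in_F_reduce; elim: w hw => //= x w IH /andP[/hk h1 /IH h2].
  by rewrite in_F_cat h1.
have KK (k l : letter T -> word T) w : (forall x, k (inv_letter x) = invw (k x)) ->
    (forall x, x.1 \in S -> ext k (l x) = [:: x]) -> in_F S w -> ext k (ext l w) = reduce w.
  move=> kV kl; rewrite ext_reduce //; elim: w => //= x w IH /andP[/kl hx /IH hw].
  by rewrite ext_cat hx hw /= reduce_idem.
have gF x : x.1 \in S -> in_F S (g x) by case/gh.
have hF x : x.1 \in S -> in_F S (h x) by case/gh.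
have gK w : in_F S w -> ext g (ext h w) = reduce w by apply: KK => // x /gh[].
have hK w : in_F S w -> ext h (ext g w) = reduce w by apply: KK => // x /gh[].
split=> [u _ hFu|u v hu hFu hv hFv|u v hu hFu hv hFv e|v hv hFv].
- by rewrite FF // reduced_reduce.
- by rewrite /mulw ext_reduce // ext_cat.
- by apply: eq_reduced => //; rewrite -hK // e hK.
- by exists (ext h v); rewrite ?FF ?reduced_reduce // gK // reduce_id.
Qed.

Lemma aut_extend S f : is_aut S f ->
  exists2 g, is_aut [set: T] g & forall u, in_F S u -> g (reduce u) = f (reduce u).
Proof.
move=> hf; have [f' hf' ff'] := aut_inverse hf.
(* [E k] is [k] on the letters of [S] and fixes the others; for [f] and its inverse [f'] this gives
   letter maps inverse to each other. *)
pose E (k : word T -> word T) x := if x.1 \in S then k [:: x] else [:: x].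
have x1 x : x.1 \in S -> in_F S [:: x] by move=> /= ->.
have EV k : is_aut S k -> forall x, E k (inv_letter x) = invw (E k x).
  move=> hk x; rewrite /E /=; case: ifP => // hx.
  by rewrite -[X in k X]reduce_id // -[X in invw (k X)]reduce_id // -(hom_inv (aut_hom hk)) ?x1.
have EF k w : is_aut S k -> in_F S w -> ext (E k) w = k (reduce w).
  move=> hk hw; rewrite (hom_letters (aut_hom hk)) // /ext; congr (reduce (flatten _)).
  by apply/eq_in_map => x /(allP hw) hx; rewrite /E hx.
exists (ext (E f)); last by move=> u hu; rewrite EF ?in_F_reduce // reduce_idem.
apply: (@ext_aut _ _ (E f')); [exact: EV|exact: EV|] => x _.
rewrite !in_FT; split=> //; rewrite /E; case: ifP => hx; try by rewrite /ext /= /E hx.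
- have := ff' _ (x1 _ hx); rewrite [reduce [:: x]]/= => -[e _].
  have h := aut_in_F hf' (x1 _ hx).
  have r := hom_reduced (aut_hom hf') (x1 _ hx).
  by rewrite -/(E f) EF // reduce_id.
- have := ff' _ (x1 _ hx); rewrite [reduce [:: x]]/= => -[_ e].
  have h := aut_in_F hf (x1 _ hx).
  have r := hom_reduced (aut_hom hf) (x1 _ hx).
  by rewrite -/(E f') EF // reduce_id.
Qed.
End Subgroups.

(** Each [e] in [es] serves at most one [E]-class, so there are at most [size es] classes. Induction
    on [es]: keep one representative [a0] served by the head, if there is one, and continue with the
    elements not equivalent to it. The case distinctions are classical because [E], [R] and [P] are
    arbitrary propositions. *)
Lemma quotient_size_bound (A B : eqType) (E : A -> A -> Prop) (R : A -> B -> Prop)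
    (es : seq B) (P : A -> Prop) :
  (forall a a', E a a' -> E a' a) ->
  (forall a a' e, P a -> P a' -> R a e -> R a' e -> E a a') ->
  (forall a, P a -> exists2 e, e \in es & R a e) ->
  exists es' : seq A,
    [/\ size es' <= size es, (forall a, a \in es' -> P a), uniq es',
        (forall a a', a \in es' -> a' \in es' -> E a a' -> a = a') &
        (forall a, P a -> exists2 a', a' \in es' & E a' a)].
Proof.
move=> Esym; elim: es P => [|e es IH] P inj cov.
  by exists [::]; split=> // a /cov[].
have [[a0 [Pa0 Ra0]]|no] := classic (exists a, P a /\ R a e); last first.
  have [es' [h1 h2 h3 h4 h5]] : exists es' : seq A,
    [/\ size es' <= size es, (forall a, a \in es' -> P a), uniq es',
        (forall a a', a \in es' -> a' \in es' -> E a a' -> a = a') &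
        (forall a, P a -> exists2 a', a' \in es' & E a' a)].
    apply: IH => // a Pa; have [e' he' Re'] := cov a Pa; exists e' => //.
    by move: he'; rewrite inE => /orP[/eqP ee|//]; case: no; exists a; rewrite -ee.
  by exists es'; split=> //; apply: leqW.
have [|a [Pa nE]|es' [h1 h2 h3 h4 h5]] := IH (fun a => P a /\ ~ E a0 a).
- by move=> a a' e' [Pa _] [Pa' _]; apply: inj.
- have [e' he' Re'] := cov a Pa; exists e' => //.
  move: he'; rewrite inE => /orP[/eqP ee|//]; case: nE.
  by apply: (inj a0 a e) => //; rewrite -ee.
exists (a0 :: es'); split.
- by rewrite /= ltnS.
- by move=> a; rewrite inE => /orP[/eqP ->|/h2[]].
- rewrite /= h3 andbT; apply/negP => /h2[_]; apply.
  exact: (inj a0 a0 e).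
- move=> a a'; rewrite !inE => /orP[/eqP ->|ha] /orP[/eqP ->|ha'] // Eaa'.
  + by case: (h2 _ ha').
  + by case: (h2 _ ha) => _; case; apply: Esym.
  + exact: h4.
- move=> a Pa; have [Ea|nE] := classic (E a0 a); first by exists a0; rewrite ?mem_head.
  by have [a' ha' Ea'] := h5 a (conj Pa nE); exists a'; rewrite // inE ha' orbT.
Qed.

(** * Core edges traversed in either direction *)

Section CoreEdges.
Variable T : finType.
Implicit Types (x y z : letter T) (u v w p q r : word T) (S : {set T}).
Implicit Types (H K L : seq (word T)) (b : T).

Lemma cyc_reduced_cons x r : cyc_reduced (x :: r) = reduced (x :: rcons r x).
Proof. by rewrite cyc_reducedE reduced_cons. Qed.

(* As [core_edge], but the edge leaving the coset of [w] may be traversed in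
   either direction, according to the sign of the letter [x]. *)
Definition core_dart S H w x : Prop :=
  exists r, [/\ cyc_reduced (x :: r), in_F S (x :: r)
              & in_sub H (reduce (w ++ (x :: r) ++ invw w))].

Lemma core_edgeE S H w b :
  core_edge S H w b <-> [/\ reduced w, in_F S w & core_dart S H w (b, true)].
Proof.
split=> [[hb hw hF [r [h1 h2 h3 h4]]]|[hw hF [r [h1 h2 h3]]]].
  split=> //; case: r h1 h2 h3 h4 => //= x r h1 h2 ex.
  by rewrite -ex mulwE; exists r.
split=> //; first by case/andP: h2.
by exists ((b, true) :: r); rewrite mulwE.
Qed.

(** Read backwards from the coset of [w x], the loop [x :: r] is labelled $x^{-1} r^{-1}$, and its
    conjugate by [w x] is the inverse of the original element. *)
Lemma core_dart_rev S H w x :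
  core_dart S H w x -> core_dart S H (reduce (w ++ [:: x])) (inv_letter x).
Proof.
case=> r [h1 h2 h3]; exists (invw r); split.
- by rewrite cyc_reduced_cons -invw_cons -invw_rcons rcons_cons reduced_invw -cyc_reduced_cons.
- by move: h2; rewrite -in_F_invw invw_cons -cats1 in_F_cat /= andbT andbC.
- have -> : reduce (reduce (w ++ [:: x]) ++ (inv_letter x :: invw r) ++
      invw (reduce (w ++ [:: x]))) = invw (reduce (w ++ (x :: r) ++ invw w)).
    rewrite -!reduce_invw reduce_catl !catA reduce_catr !invw_cat invwK invw_cons -!catA -cats1 /=.
    apply: reduce_congr => //; rewrite [invw (x :: r)]invw_cons -cats1 -catA.
    exact: (reduce_cancelr [:: x]).
  exact: in_sub_inv.
Qed.

Lemma edge_equiv_sym H e e' : edge_equiv H e e' -> edge_equiv H e' e.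
Proof.
case=> h1 h2; split=> //; move/in_sub_inv: h2.
by rewrite /mulw -reduce_invw invw_cat invwK.
Qed.

Lemma edge_equiv_trans H e e' e'' :
  edge_equiv H e e' -> edge_equiv H e' e'' -> edge_equiv H e e''.
Proof.
case=> h1 h2 [h3 h4]; split; first by rewrite h1.
have := in_sub_mul h4 h2; rewrite /mulw reduce_catl reduce_catr -catA.
by rewrite -reduce_catr reduce_cancell reduce_catr.
Qed.

End CoreEdges.

(** * Bases with isolated letters, and the injection of core edges *)

Section Isolated.
Variables (T : finType) (S : {set T}) (psi : word T -> word T).
Variables (t : letter T -> word T) (c : letter T -> letter T).
Implicit Types (x y z : letter T) (u v w p q r s : word T).

(* [t y] and [t (inv_letter y)] are the tree paths from the base point to the
   two ends of the edge [c y] dual to [y]. *)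
Definition turn y z := reduce (invw (t (inv_letter y)) ++ t z).

Hypothesis psi_hom : is_hom S psi.
Hypothesis cV : forall y, c (inv_letter y) = inv_letter (c y).
Hypothesis psi_letter :
  forall y, y.1 \in S -> psi [:: y] = t y ++ c y :: invw (t (inv_letter y)).
Hypothesis turn_reduced : forall y z, y.1 \in S -> z.1 \in S -> noncancel y z ->
  reduced (c y :: rcons (turn y z) (c z)).

(** The middle part of the image of [y :: r]: it runs from the first isolated letter to the last
    one, without the tree paths at both ends. *)
Fixpoint walk y r :=
  c y :: (if r is z :: r' then turn y z ++ walk z r' else [::]).

Lemma walk_cons y r : walk y r = c y :: behead (walk y r).
Proof. by case: r. Qed.

Lemma size_walk y r : size r < size (walk y r).
Proof. by elim: r y => //= z r IH y; have := IH z; rewrite size_cat; lia. Qed.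

(** Reducedness is local, and consecutive segments of the form [c y], turn, [c z] overlap in one
    letter, so [turn_reduced] suffices. *)
Lemma walk_reduced y r : in_F S (y :: r) -> reduced (y :: r) -> reduced (walk y r).
Proof.
elim: r y => // z r IH y; rewrite reduced_cons => hF hp.
case/and3P: (hF) => hy hz hr; case/andP: (hp) => yz zr.
have : reduced (walk z r) by apply: IH; rewrite ?reduced_cons //=; apply/andP.
rewrite [walk y _]/= walk_cons -cat_cons reduced_cat_cons => ->.
by rewrite andbT rcons_cons turn_reduced.
Qed.

Lemma walk_rcons y r z :
  walk y (rcons r z) = walk y r ++ rcons (turn (last y r) z) (c z).
Proof. by elim: r y => [|x r IH] y /=; rewrite ?cats1 // IH catA. Qed.

Lemma psi_walk y r : in_F S (y :: r) -> psi (reduce (y :: r)) =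
  reduce (t y ++ walk y r ++ invw (t (inv_letter (last y r)))).
Proof.
elim: r y => [|z r IH] y hF.
  have hy : y.1 \in S by case/andP: hF.
  rewrite psi_letter //= [RHS]reduce_id // -psi_letter //.
  by apply: psi_hom.1 => //=; rewrite hy.
case/andP: (hF) => hy hr.
rewrite -cat1s (hom_cat psi_hom) // ?IH //= ?hy // psi_letter // reduce_catr -!catA.
apply: reduce_congr => //=; congr (push _ _); rewrite catA.
by apply: reduce_congr => //; rewrite reduce_idem.
Qed.

Lemma walk_uniq y r m : in_F S (y :: r) -> reduced (y :: r) ->
  psi (y :: r) = reduce (t y ++ m ++ invw (t (inv_letter (last y r)))) ->
  reduce m = walk y r.
Proof.
move=> hF hr; rewrite -[in LHS](reduce_id hr) psi_walk // => /reduce_catIl/reduce_catIr <-.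
by rewrite reduce_id // walk_reduced.
Qed.

(* The edges [c y] based at the cosets of [t y] are pairwise distinct in the
   cover of the image of [psi]. *)
Lemma separated y z s : y.1 \in S -> z.1 \in S -> in_F S s -> reduced s ->
  c y = c z -> reduce (t y) = reduce (psi s ++ t z) -> y = z /\ s = [::].
Proof.
move=> hy hz hF hs cyz ty.
have hy1 : in_F S [:: inv_letter y] by rewrite /= hy.
have hz1 : in_F S [:: z] by rewrite /= hz.
(* [A3], [A1], [A2] and [A0] treat $s$, $sz$, $y^{-1}s$ and $y^{-1}sz$: between tree paths, each
   image has a middle part of at most one letter. *)
have A3 : psi s = reduce (t y ++ [::] ++ invw (t z)).
  rewrite -reduce_catl ty reduce_catl -catA -reduce_catr reduce_invr cats0.
  by rewrite reduce_id // -(reduce_id hs) (hom_reduced psi_hom).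
have A1 : psi (reduce (rcons s z)) = reduce (t y ++ [:: c z] ++ invw (t (inv_letter z))).
  rewrite -cats1 (hom_cat psi_hom) // (reduce_id hs) psi_letter // catA -reduce_catl -ty.
  by rewrite reduce_catl.
have A2 : psi (reduce (inv_letter y :: s)) =
    reduce (t (inv_letter y) ++ [:: inv_letter (c y)] ++ invw (t z)).
  rewrite -cat1s (hom_cat psi_hom) // (reduce_id hs) psi_letter ?inv_letterK // A3 reduce_catr -!catA.
  apply: reduce_congr => //=; rewrite cV; congr (push _ _).
  by rewrite reduce_cancell.
have A0 : psi (reduce (inv_letter y :: rcons s z)) =
    reduce (t (inv_letter y) ++ [::] ++ invw (t (inv_letter z))).
  rewrite -cat1s (hom_cat psi_hom) // ?A1 ?psi_letter ?inv_letterK //; last first.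
    by rewrite -cats1 in_F_cat hF.
  rewrite reduce_catr -!catA cV cyz; apply: reduce_congr => //.
  rewrite -cat1s -catA -reduce_catr reduce_cancell reduce_catr.
  by rewrite -[[:: inv_letter _]]/(invw [:: c z]) reduce_cancell.
case: (eqVneq s [::]) => [es|].
  case: (eqVneq y z) => [-> //|nyz].
  have /walk_uniq : psi [:: inv_letter y; z] =
     reduce (t (inv_letter y) ++ [::] ++ invw (t (inv_letter (last (inv_letter y) [:: z])))).
    by rewrite -A0 es [in RHS]reduce_id //= inv_letterK eq_sym nyz.
  rewrite /= hy hz inv_letterK eq_sym nyz /=; move=> /(_ isT isT) //.
case: s hF hs A0 A1 A2 A3 {ty} => // a s hF hs A0 A1 A2 A3 _.
have ne1 : last a s != inv_letter z -> noncancel (last a s) z.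
  by rewrite /noncancel [z == _]eq_sym eq_inv_letter.
(* The letters $y^{-1}$ and $z$ are attached to [s] only at the ends where they do not cancel. The
   resulting word is reduced, so [walk_uniq] identifies its walk with the short middle part,
   although the walk is too long for that. *)
exfalso; case: (eqVneq a y) => [eay|nay]; rewrite -?eay in A1 A3; case: (eqVneq (last a s) (inv_letter z)) => [el|/ne1 nl].
- have := @walk_uniq a s [::] hF hs; rewrite el inv_letterK => /(_ A3) /=.
  by rewrite walk_cons.
- have hF' : in_F S (a :: rcons s z) by rewrite -rcons_cons -cats1 in_F_cat hF.
  have hr' : reduced (a :: rcons s z).
    by rewrite reduced_cons rcons_path -reduced_cons hs.
  have := @walk_uniq a (rcons s z) [:: c z] hF' hr'; rewrite last_rcons -{1}(reduce_id hr').
  rewrite -rcons_cons => /(_ A1) /= e.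
  by have := size_walk a (rcons s z); rewrite -e size_rcons.
- have hF' : in_F S (inv_letter y :: a :: s) by rewrite /= hy.
  have hr' : reduced (inv_letter y :: a :: s).
    by rewrite reduced_cons /= -reduced_cons hs andbT /noncancel inv_letterK.
  have := @walk_uniq _ (a :: s) [:: inv_letter (c y)] hF' hr'; rewrite -{1}(reduce_id hr').
  rewrite [last _ _]/= el inv_letterK => /(_ A2) e.
  by have := size_walk (inv_letter y) (a :: s); rewrite -e.
- have hF' : in_F S (inv_letter y :: rcons (a :: s) z) by rewrite -cats1 -cat1s !in_F_cat hy1 hF hz1.
  have hr' : reduced (inv_letter y :: rcons (a :: s) z).
    rewrite reduced_cons rcons_path /= -reduced_cons hs nl.
    by rewrite /noncancel inv_letterK nay.
  have := @walk_uniq _ (rcons (a :: s) z) [::] hF' hr'; rewrite -{1}(reduce_id hr').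
  rewrite last_rcons => /(_ A0).
  by rewrite walk_cons.
Qed.

Variables K L : seq (word T).
Hypothesis KS : forall g, g \in K -> in_F S g.
Hypothesis LK : forall v, in_sub L v <-> exists2 u, in_sub K u & v = psi u.

Lemma core_dart_psi w y : reduced w -> in_F S w ->
  core_dart S K w y -> core_dart [set: T] L (reduce (psi w ++ t y)) (c y).
Proof.
move=> hw hF [r [hr hFr hK]].
(* The image loop closes up with the turn from the last letter back to [y]; it is cyclically reduced
   because [rcons r1 (c y)] is the walk of [y :: rcons r y]. *)
pose r1 := walk y r ++ turn (last y r) y.
have er1 : r1 = c y :: behead r1 by rewrite /r1 walk_cons.
have hy : y.1 \in S by case/andP: hFr.
exists (behead r1); split; rewrite ?in_FT //.
  rewrite cyc_reduced_cons -rcons_cons -er1 /r1 -cats1 -catA cats1 -walk_rcons.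
  rewrite walk_reduced //; last by rewrite -cyc_reduced_cons.
  by rewrite -cats1 -cat_cons in_F_cat hFr /= hy.
rewrite -er1; apply/LK; exists (reduce (w ++ (y :: r) ++ invw w)) => //.
have hFi : in_F S (invw w) by rewrite in_F_invw.
rewrite !(hom_cat psi_hom) // ?in_F_cat ?hFr // psi_walk // (hom_inv psi_hom) // (reduce_id hw).
rewrite reduce_catl -reduce_invw !catA reduce_catr invw_cat -!catA [RHS]reduce_catr.
apply: reduce_congr => //; rewrite reduce_catl -!catA.
apply: reduce_congr => //; apply: reduce_congr => //.
by rewrite /turn reduce_catl -catA; apply: reduce_congr => //; rewrite reduce_cancelr.
Qed.

(** Core edges are named by positive letters, but [c (b, true)] may be negative. In that case the
    edge is taken from its other end, where it reads [(b, false)], whose isolated letter is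
    positive. *)
Definition pos_letter (b : T) : letter T := (b, (c (b, true)).2).
Definition pos_base w (b : T) := if (c (b, true)).2 then w else reduce (w ++ [:: (b, true)]).
Definition edge_image (e : word T * T) : word T * T :=
  (reduce (psi (pos_base e.1 e.2) ++ t (pos_letter e.2)), (c (e.2, true)).1).

Lemma c_pos_letter b : c (pos_letter b) = ((c (b, true)).1, true).
Proof.
rewrite /pos_letter; case E : (c (b, true)) => [a []] //=.
by rewrite -[(b, false)]/(inv_letter (b, true)) cV E.
Qed.

Lemma pos_baseP w b : core_edge S K w b ->
  [/\ reduced (pos_base w b), in_F S (pos_base w b), b \in S
     & core_dart S K (pos_base w b) (pos_letter b)].
Proof.
move=> h; have hb : b \in S by case: h.
case/core_edgeE: h => hw hF h; rewrite /pos_base /pos_letter.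
case: (c _).2 => //; rewrite reduced_reduce in_F_reduce //; last by rewrite in_F_cat hF /= hb.
by split=> //; apply: core_dart_rev h.
Qed.

Lemma edge_image_core w b : core_edge S K w b ->
  core_edge [set: T] L (edge_image (w, b)).1 (edge_image (w, b)).2.
Proof.
case/pos_baseP=> h1 h2 h3 h4; apply/core_edgeE.
rewrite reduced_reduce in_FT -c_pos_letter; split=> //.
exact: core_dart_psi.
Qed.

Lemma edge_image_inj w b w' b' : core_edge S K w b -> core_edge S K w' b' ->
  edge_equiv L (edge_image (w, b)) (edge_image (w', b')) -> edge_equiv K (w, b) (w', b').
Proof.
move=> /pos_baseP[r1 F1 hb _] /pos_baseP[r2 F2 hb' _] [/= cc /LK[k hk]].
have kF := in_sub_in_F KS hk; have kr := in_sub_reduced hk.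
set v := pos_base w b in r1 F1 *; set v' := pos_base w' b' in r2 F2 *.
rewrite /mulw reduce_catl -reduce_invw reduce_catr => e.
have Fs : in_F S (invw v' ++ k ++ v) by rewrite !in_F_cat in_F_invw F2 kF.
(* The equivalence of the images says that $\psi(v')\,t' = \psi(k)\,\psi(v)\,t$ for some [k] in the
   subgroup generated by [K]. Solving for $t'$ gives the situation of [separated], which forces $b'
   = b$ and $v' = kv$. *)
have et : reduce (t (pos_letter b')) =
    reduce (psi (reduce (invw v' ++ k ++ v)) ++ t (pos_letter b)).
  have -> : psi (reduce (invw v' ++ k ++ v)) = reduce (invw (psi v') ++ psi k ++ psi v).
    rewrite !(hom_cat psi_hom) ?in_F_cat ?in_F_invw ?kF // (hom_inv psi_hom) //.
    by rewrite (reduce_id r1) (reduce_id r2) (reduce_id kr) reduce_catr.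
  rewrite reduce_catl -e -!catA -[RHS]reduce_catr reduce_catl reduce_catr -!catA reduce_cancell.
  by rewrite -[RHS]reduce_catr reduce_invl cats0.
have [|||||ey es] := separated _ _ _ _ _ et; rewrite ?reduced_reduce ?in_F_reduce //=.
  by rewrite !c_pos_letter cc.
have ev : v' = reduce (k ++ v).
  apply: eq_reduced; rewrite ?reduced_reduce //; apply: (@reduce_catIl _ (invw v')).
  by rewrite reduce_catr es reduce_invl.
have eb : b' = b by case: ey.
split; rewrite ?eb //=.
suff ew : reduce w' = reduce (k ++ w).
  rewrite /mulw -reduce_catl ew reduce_catl -catA -reduce_catr reduce_invr cats0.
  by rewrite reduce_id.
move: ev; rewrite /v /v' /pos_base eb; case: ifP => _; first by move=> ->; rewrite reduce_idem.
by rewrite reduce_catr catA => /reduce_catIr.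
Qed.

(** Since [core_size] is a relation, the finiteness of the core for [K] has to be derived too;
    [quotient_size_bound] gives it together with the inequality. *)
Lemma core_size_le m : core_size [set: T] L m -> exists2 m', m' <= m & core_size S K m'.
Proof.
move=> [es [<- h1 _ h3 h4]].
have [|[w b] [w' b'] e h h' /= he he'|[w b] h|es' [g1 g2 g3 g4 g5]] :=
   @quotient_size_bound _ _ (edge_equiv K) (fun a e => edge_equiv L e (edge_image a)) es
     (fun a => core_edge S K a.1 a.2).
- exact: edge_equiv_sym.
- by apply: edge_image_inj => //; apply: edge_equiv_trans he'; apply: edge_equiv_sym.
- exact/h4/edge_image_core.
exists (size es') => //; exists es'; split=> // w b h.
exact: (g5 (w, b)).
Qed.

End Isolated.

Lemma ex_min_measure (A : Type) (P : A -> Prop) (m : A -> nat) :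
  (exists a, P a) -> exists2 a, P a & forall a', P a' -> m a <= m a'.
Proof.
case=> a; have [n] := ubnP (m a); elim: n a => // n IH a lt_n Pa.
have [[a' [Pa' lt_a]]|no] := classic (exists a', P a' /\ m a' < m a).
  by apply: IH Pa'; apply: leq_trans lt_a lt_n.
exists a => // a' Pa'; rewrite leqNgt; apply/negP => lt_a.
by apply: no; exists a'.
Qed.

(** * The shortlex order and cancellation between reduced words *)

Section Shortlex.
Variable T : finType.
Implicit Types (x y z a b : letter T) (u v w p q r : word T) (S : {set T}).

Definition letter_rank x : nat := enum_rank (x : T * bool).

(** The word read as a numeral in base [#|{: T * bool}|]: among words of equal length, codes are
    ordered lexicographically. *)
Definition code (w : word T) : nat :=
  foldl (fun n x => n * #|{: T * bool}| + letter_rank x) 0 w.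

Lemma letter_rank_lt x : letter_rank x < #|{: T * bool}|.
Proof. exact: ltn_ord. Qed.

Lemma code_rcons w x : code (rcons w x) = code w * #|{: T * bool}| + letter_rank x.
Proof. by rewrite /code foldl_rcons. Qed.

Lemma code_cat u v : code (u ++ v) = code u * #|{: T * bool}| ^ size v + code v.
Proof.
elim/last_ind: v => [|v x IH]; first by rewrite cats0 muln1 addn0.
by rewrite -rcons_cat !code_rcons IH size_rcons mulnDl expnSr mulnA addnA.
Qed.

Lemma code_lt w : code w < #|{: T * bool}| ^ size w.
Proof.
elim/last_ind: w => [|w x IH] //; rewrite code_rcons size_rcons expnSr.
have := letter_rank_lt x; move: (letter_rank x) IH => d; nia.
Qed.

Lemma code_inj u v : size u = size v -> code u = code v -> u = v.
Proof.
elim/last_ind: u v => [|u x IH] v; first by case: v.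
case/lastP: v => [|v y]; rewrite !size_rcons // => -[es]; rewrite !code_rcons => e.
have N0 : 0 < #|{: T * bool}| by apply: leq_trans (letter_rank_lt x).
have eq1 : code u = code v.
  by move/(congr1 (divn^~ #|{: T * bool}|)): e; rewrite !divnMDl // !divn_small ?addn0 ?letter_rank_lt.
move: e; rewrite (IH v) // => /addnI e; congr rcons.
exact/enum_rank_inj/val_inj.
Qed.

Definition shortlex u v := (size u < size v) || (size u == size v) && (code u < code v).

Lemma shortlex_total u v : u != v -> ~~ shortlex u v -> shortlex v u.
Proof.
rewrite /shortlex; case: (ltngtP (size u) (size v)) => //= es /eqP ne.
by case: (ltngtP (code u) (code v)) => // ec; case: ne; apply: code_inj.
Qed.

(* The letter [x] of [u] where the shortlex-smaller of the two arcs joining a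
   point of the loop [u] to its base point changes sides. *)
Lemma shortlex_split u : reduced u -> u != [::] -> exists t x t',
  [/\ u = t ++ x :: invw t', shortlex t (rcons t' (inv_letter x)) & shortlex t' (rcons t x)].
Proof.
(* [Q i] says that the arc of length [i] from the start beats the arc from the other end; it holds
   at 0 and fails at [size u], so it changes between some [i] and [i.+1]. *)
move=> ru u0; pose Q i := shortlex (take i u) (invw (drop i u)).
have Q0 : Q 0 by rewrite /Q take0 drop0 /shortlex size_invw /= lt0n size_eq0 u0.
have Qn : ~~ Q (size u) by rewrite /Q take_size drop_size /shortlex; case: (u) u0.
have [i ltiu /andP[Qi nQi]] : exists2 i, i < size u & Q i && ~~ Q i.+1.
  elim: (size u) Qn => [|n IH]; first by rewrite Q0.
  move=> nQ; case: (boolP (Q n)) => [Qn|/IH[i lt_i Qi]]; first by exists n; rewrite // Qn nQ.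
  by exists i => //; apply: leqW.
case: u ru u0 @Q Q0 Qn ltiu Qi nQi => // x0 u0; set u := x0 :: u0 => ru _ Q _ _ ltiu Qi nQi.
exists (take i u), (nth x0 u i), (invw (drop i.+1 u)).
have eu : u = take i u ++ nth x0 u i :: invw (invw (drop i.+1 u)).
  by rewrite invwK -drop_nth ?cat_take_drop.
split=> //; first by move: Qi; rewrite /Q (drop_nth x0) // invw_cons.
move: nQi; rewrite /Q (take_nth x0) //; apply: shortlex_total.
(* Equal arcs would make [u] a word followed by its inverse, which reduces to the empty word. *)
apply/eqP => e; move: (congr1 (@reduce T) eu); rewrite -cat_rcons e reduce_invr.
by rewrite reduce_id.
Qed.

Lemma reduced_junction a p b q : reduced (a :: p) -> reduced (b :: q) -> a != b ->
  reduced (invw (a :: p) ++ b :: q).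
Proof.
move=> ra rb ab; have := ra; rewrite -reduced_invw invw_cons => ra'.
by rewrite cat_rcons reduced_cat_cons ra' reduced_cons /= -reduced_cons rb /noncancel inv_letterK eq_sym ab.
Qed.

(** Cancellation in $p^{-1}q$ only strips the common prefix of [p] and [q]. It could reach [a] or
    [b] only if one marked prefix, [rcons p a] or [rcons q b], began the other word. *)
Lemma reduced_turn p a u q b v :
  reduced (p ++ a :: u) -> reduced (q ++ b :: v) ->
  (forall w, q ++ b :: v <> rcons p a ++ w) -> (forall w, p ++ a :: u <> rcons q b ++ w) ->
  reduced (inv_letter a :: rcons (reduce (invw p ++ q)) b).
Proof.
elim: p q => [|a1 p IH] q hp hq npq nqp.
  have hq' : reduced (rcons q b) by move: hq; rewrite reduced_cat_cons => /andP[].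
  rewrite /= reduce_id; last by move: hq' ; rewrite -cats1 => /reduced_catl.
  case: q hq hq' npq nqp => [|b1 q] /= hq hq' npq nqp; rewrite ?hq' ?andbT inv_letterK;
    by apply/eqP => e; apply: (npq _); rewrite e.
have hp' : reduced (rcons (a1 :: p) a) by move: hp; rewrite reduced_cat_cons => /andP[].
have hq' : reduced (rcons q b) by move: hq; rewrite reduced_cat_cons => /andP[].
have key b1 q1 : rcons q b = b1 :: q1 -> a1 != b1 ->
    reduced (inv_letter a :: rcons (reduce (invw (a1 :: p) ++ q)) b).
  move=> e ne; have : reduced (invw (rcons (a1 :: p) a) ++ rcons q b).
    by rewrite e; apply: reduced_junction; rewrite -?e.
  rewrite invw_rcons cat_cons -rcons_cat => h.
  rewrite reduce_id //; move: h; rewrite -rcons_cons -cats1 => /reduced_catl.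
  by rewrite -cat1s => /reduced_catr.
case: q hq npq nqp hq' key => [|b1 q] hq npq nqp hq' key.
  apply: (key b [::]) => //; apply/eqP => e; apply: (nqp (p ++ a :: u)).
  by rewrite e.
case: (eqVneq a1 b1) => [e|ne]; last exact: key ne.
have -> : reduce (invw (a1 :: p) ++ b1 :: q) = reduce (invw p ++ q).
  rewrite invw_cons -cats1 -catA e -reduce_catr.
  by rewrite (reduce_cancell [:: b1]) reduce_catr.
apply: IH.
- exact: (@reduced_catr _ [:: a1] _ hp).
- exact: (@reduced_catr _ [:: b1] _ hq).
- by move=> w ew; apply: (npq w); rewrite e /= ew.
- by move=> w ew; apply: (nqp w); rewrite e /= ew.
Qed.

End Shortlex.

Lemma letter_eq_of_index (T : finType) (y z : letter T) :
  y.1 = z.1 -> z != inv_letter y -> z = y.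
Proof.
case: y z => [a b] [a' b'] /= <-; rewrite /inv_letter xpair_eqE eqxx /=.
by case: b b' => [] [].
Qed.

(** There is no element of order two: the outer letters of such a word are inverse to each other,
    and the middle is again its own inverse, hence empty, which leaves a cancelling pair. *)
Lemma reduced_self_inverse (T : finType) (w : word T) : reduced w -> w = invw w -> w = [::].
Proof.
have [n] := ubnP (size w); elim: n w => // n IH [|a w] // lt_n rw.
case/lastP: w lt_n rw => [|w b] lt_n rw.
  by move=> [e]; have := inv_letter_neq a; rewrite -e eqxx.
rewrite invw_cons invw_rcons => -[ea] /rcons_inj[ew eb].
have w0 : w = [::].
  apply: IH ew; first by move: lt_n; rewrite /= size_rcons; lia.
  apply: (@reduced_catr _ [:: a]); apply: (@reduced_catl _ _ [:: b]).
  by rewrite -catA cats1.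
by move: rw; rewrite w0 /= eb eqxx.
Qed.

(** * Nielsen moves and a minimal basis *)

Section Nielsen.
Variables (T : finType) (S : {set T}).
Implicit Types (x y z : letter T) (u v w p q r : word T).

(** The elementary Nielsen move $z \mapsto yz$. Both letters carry signs, so a negative [z] gives
    the multiplications on the right. *)
Definition transvection y z x : word T :=
  if x == z then [:: y; z]
  else if x == inv_letter z then [:: inv_letter z; inv_letter y] else [:: x].

Lemma transvection_id y z x : x.1 != z.1 -> transvection y z x = [:: x].
Proof.
by move=> h; rewrite /transvection !ifN //; apply: contra h => /eqP ->.
Qed.

Lemma transvection_inv y z x :
  transvection y z (inv_letter x) = invw (transvection y z x).
Proof.
rewrite /transvection eq_inv_letter (inj_eq (inv_inj (@inv_letterK T))).
case: (eqVneq x z) => [->|nz].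
  by rewrite eq_sym (negbTE (inv_letter_neq z)).
by case: eqP => // _; rewrite /invw /= /rev /= !inv_letterK.
Qed.

Lemma ext_transvection y z : y.1 != z.1 ->
  ext (transvection y z) [:: z] = [:: y; z].
Proof.
move=> yz; rewrite /ext /= cats0 /transvection eqxx reduce_id //= andbT.
by apply: contra yz => /eqP ->.
Qed.

Lemma transvectionK y z x : y.1 != z.1 ->
  ext (transvection y z) (transvection (inv_letter y) z x) = [:: x].
Proof.
move=> yz; rewrite {2}/transvection; case: eqP => [->|nz].
  rewrite -cat1s ext_cat ext_transvection // /ext /= transvection_id // cats0 reduce_catl.
  exact: (reduce_cancell [:: y]).
case: eqP => [->|nz']; last first.
  by rewrite /ext /= /transvection; move/eqP/negbTE: nz => ->; move/eqP/negbTE: nz' => ->.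
rewrite inv_letterK /ext [flatten _]/= (transvection_id _ yz) transvection_inv.
by rewrite /transvection eqxx /invw /rev /= inv_letterK eqxx.
Qed.

Lemma transvection_aut y z : y.1 \in S -> z.1 \in S -> y.1 != z.1 ->
  is_aut S (ext (transvection y z)).
Proof.
move=> hy hz yz; apply: (@ext_aut _ _ _ (transvection (inv_letter y) z)).
- exact: transvection_inv.
- exact: transvection_inv.
move=> x hx; split; last 2 first.
- exact: transvectionK.
- by have := @transvectionK (inv_letter y) z x yz; rewrite inv_letterK.
- by rewrite /transvection; do 2?case: ifP => _; rewrite /= ?hx ?hy ?hz.
- by rewrite /transvection; do 2?case: ifP => _; rewrite /= ?hx ?hy ?hz.
Qed.

Lemma id_aut : is_aut S id.
Proof. by split=> // [u -> ->|v hv hF]; last by exists v; rewrite ?hv. Qed.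

Variable f : word T -> word T.
Hypothesis f_hom : is_hom [set: T] f.

Definition total (F : word T -> nat) (beta : word T -> word T) : nat :=
  \sum_(b in S) F (f (beta [:: (b, true)])).

Lemma hom_letter_inv g y : is_hom S g -> y.1 \in S ->
  g [:: inv_letter y] = invw (g [:: y]).
Proof. by move=> hg hy; apply: (hom_inv hg (u := [:: y])); rewrite /= hy. Qed.

(** Only the summand of [z.1] changes. [F] is invariant under inversion because [z] may be negative
    while the sum runs over positive letters; the additive form avoids truncated subtraction. *)
Lemma total_transvection F beta y z : (forall u, F (invw u) = F u) ->
  is_aut S beta -> y.1 \in S -> z.1 \in S -> y.1 != z.1 ->
  total F (beta \o ext (transvection y z)) + F (f (beta [:: z])) =
  total F beta + F (reduce (f (beta [:: y]) ++ f (beta [:: z]))).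
Proof.
move=> Finv hb hy hz yz; have hn := transvection_aut hy hz yz.
have Fpos g : is_aut S g -> F (f (g [:: (z.1, true)])) = F (f (g [:: z])).
  move=> hg; have hom := is_hom_comp hg f_hom.
  case: z hz {yz hn} => a [] //= ha.
  by have /= := hom_letter_inv hom (y := (a, true)) ha; rewrite -[inv_letter _]/(a, false) => ->.
rewrite /total !(bigD1 z.1 hz) /=.
rewrite -/((beta \o ext (transvection y z)) [:: (z.1, true)]) !Fpos //; last exact: is_aut_comp.
rewrite /= ext_transvection //.
have -> : f (beta [:: y; z]) = reduce (f (beta [:: y]) ++ f (beta [:: z])).
  have := hom_cat (is_hom_comp hb f_hom) (u := [:: y]) (v := [:: z]).
  rewrite /in_F /= hy hz => /(_ isT isT) <-.
  by case: eqP => // ezy; move: yz; rewrite ezy eqxx.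
rewrite (eq_bigr (fun b => F (f (beta [:: (b, true)])))); first by lia.
by move=> b /andP[_ nb]; rewrite /ext /= transvection_id.
Qed.

(** Adding the code of the inverse gives the inversion invariance that [total_transvection] asks
    for. *)
Definition code_sym (u : word T) := code u + code (invw u).

(* Nielsen reduction: length alone does not rule out cancelling both halves of
   an even-length basis element, hence the second measure. *)
Lemma nielsen_minimal : exists2 beta, is_aut S beta &
  forall y z, y.1 \in S -> z.1 \in S -> y.1 != z.1 ->
    let u := f (beta [:: z]) in let v := reduce (f (beta [:: y]) ++ u) in
    size u <= size v /\ (size u = size v -> code_sym u <= code_sym v).
Proof.
have [b1 hb1 min1] := ex_min_measure (P := is_aut S) (total size) (ex_intro _ _ id_aut).
have [beta [hb e1] min2] := ex_min_measure
  (P := fun g => is_aut S g /\ total size g = total size b1) (total code_sym)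
  (ex_intro _ _ (conj hb1 erefl)).
exists beta => // y z hy hz yz u v.
have h' := is_aut_comp hb (transvection_aut hy hz yz).
have t1 := total_transvection (@size_invw T) hb hy hz yz.
have cs w : code_sym (invw w) = code_sym w by rewrite /code_sym invwK addnC.
have t2 := total_transvection cs hb hy hz yz.
have m1 := min1 _ h'; rewrite -e1 in m1; split.
  by rewrite -(leq_add2l (total size beta)) -t1 leq_add2r.
(* With equal sizes the move preserves the total length, so the new basis competes in the second
   minimisation. *)
move=> es; rewrite -(leq_add2l (total code_sym beta)) -t2 leq_add2r.
apply: min2; split=> //; rewrite -e1.
by apply: (@addIn (size u)); rewrite t1 -/u -/v es.
Qed.
End Nielsen.

(** * Isolated letters in a minimal basis *)

Section NielsenReduced.
Variables (T : finType) (S : {set T}) (psi : word T -> word T).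
Implicit Types (x y z : letter T) (u v w p q r : word T).
Hypothesis psi_hom : is_hom S psi.
Hypothesis psi_neq0 : forall y, y.1 \in S -> psi [:: y] != [::].
Hypothesis psi_min : forall y z, y.1 \in S -> z.1 \in S -> y.1 != z.1 ->
  let u := psi [:: z] in let v := reduce (psi [:: y] ++ u) in
  size u <= size v /\ (size u = size v -> code_sym u <= code_sym v).

(** If $z = y$, then $qw = pq^{-1}$ gives $q = pd$ with $d = d^{-1}$, so $p = q$. Otherwise the move
    $z \mapsto yz$ would replace $qw$ by $pw$, smaller in length or, when [p] and [q] have equal
    length, in [code_sym]. *)
Lemma not_prefix y z p q w : y.1 \in S -> z.1 \in S -> z != inv_letter y ->
  psi [:: y] = p ++ invw q -> shortlex p q -> psi [:: z] <> q ++ w.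
Proof.
move=> hy hz nzy ey pq ez.
have ry : reduced (psi [:: y]) by apply: psi_hom.1; rewrite //= hy.
case: (eqVneq y.1 z.1) => [e1|yz].
  move: ez; rewrite (letter_eq_of_index e1 nzy) ey => epq.
  have le_pq : size p <= size q by case/orP: pq => [/ltnW //|/andP[/eqP ->]].
  have [d ed] : exists d, q = p ++ d.
    exists (drop (size p) q); rewrite -{1}(cat_take_drop (size p) q); congr (_ ++ _).
    by move/(congr1 (take (size p))): epq; rewrite take_size_cat // takel_cat.
  move: epq; rewrite ed invw_cat -catA => /eqP; rewrite eqseq_cat // eqxx /=.
  rewrite eqseq_cat ?size_invw // => /andP[/eqP dd _].
  have rd : reduced d.
    move: ry; rewrite ey ed invw_cat => /reduced_catr/reduced_catl.
    by rewrite reduced_invw.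
  by move: pq; rewrite ed (reduced_self_inverse rd) // cats0 /shortlex eqxx !ltnn.
have [m1 m2] := psi_min hy hz yz.
(* Minimality of the image of $y^{-1}$ under multiplication by that of $z^{-1}$ yields
   [size q <= size w], needed to compare codes. *)
have [m3 _] := psi_min (y := inv_letter z) (z := inv_letter y) hz hy ltac:(by rewrite eq_sym).
have epw : reduce (psi [:: y] ++ psi [:: z]) = reduce (p ++ w).
  by rewrite ey ez -catA -reduce_catr reduce_cancell reduce_catr.
move: m3; rewrite !(hom_letter_inv psi_hom) // -invw_cat reduce_invw !size_invw.
move: m1 m2; rewrite epw => m1 m2 m3.
have := size_reduce (p ++ w); rewrite size_cat => le_pw.
move: m1 m3; rewrite ez ey !size_cat size_invw => m1 m3.
case/orP: pq => [lt_pq|/andP[/eqP es lt_pq]]; first by lia.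
have epw' : reduce (p ++ w) = p ++ w by apply: reduce_size_id; rewrite size_cat; lia.
move: m2; rewrite epw' ez !size_cat es => /(_ erefl).
rewrite /code_sym !invw_cat !code_cat !size_invw es.
have := code_lt (invw p); rewrite size_invw es.
have le_qw : size q <= size w by lia.
have N0 : 0 < #|{: T * bool}|.
  by apply: leq_trans (letter_rank_lt y).
have := leq_pexp2l N0 le_qw.
move: (code p) (code q) lt_pq => cp cq lt_pq hN.
(* The leading parts differ by at least [#|{: T * bool}| ^ size w], which exceeds [code (invw p)]
   since [size q <= size w]. *)
have : (cp + 1) * #|{: T * bool}| ^ size w <= cq * #|{: T * bool}| ^ size w.
  by rewrite leq_mul2r addn1 lt_pq orbT.
rewrite mulnDl mul1n.
move: (_ ^ size w) (_ ^ size q) hN => Nw Nq hN.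
move: (cq * Nw) (cp * Nw) (code (invw w) * Nq) (code _) (code _) (code _) => *; lia.
Qed.

Lemma isolated_split : exists (t : letter T -> word T) (c : letter T -> letter T),
  [/\ forall y, c (inv_letter y) = inv_letter (c y),
      forall y, y.1 \in S -> psi [:: y] = t y ++ c y :: invw (t (inv_letter y)) &
      forall y z, y.1 \in S -> z.1 \in S -> noncancel y z ->
        reduced (c y :: rcons (turn t y z) (c z))].
Proof.
(* Splittings are chosen for positive letters only and carried to negative ones by inversion, which
   makes [cV] hold by construction. *)
pose P (b : T) (d : word T * letter T * word T) := (b \in S) ==>
  [&& psi [:: (b, true)] == d.1.1 ++ d.1.2 :: invw d.2,
      shortlex d.1.1 (rcons d.2 (inv_letter d.1.2)) & shortlex d.2 (rcons d.1.1 d.1.2)].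
have ex b : exists d, P b d.
  rewrite /P; case: (boolP (b \in S)) => hb; last by exists ([::], (b, true), [::]).
  have rb : reduced (psi [:: (b, true)]) by apply: psi_hom.1; rewrite //= hb.
  have [t [x [t' [-> h1 h2]]]] := shortlex_split rb (psi_neq0 (y := (b, true)) hb).
  by exists (t, x, t'); rewrite /= eqxx h1.
pose d b := xchoose (ex b).
pose t (y : letter T) := if y.2 then (d y.1).1.1 else (d y.1).2.
pose c (y : letter T) := if y.2 then (d y.1).1.2 else inv_letter (d y.1).1.2.
have cV y : c (inv_letter y) = inv_letter (c y).
  by case: y => b []; rewrite /c //= inv_letterK.
have dP b : b \in S -> P b (d b) by move=> _; apply: xchooseP.
have tc y : y.1 \in S -> psi [:: y] = t y ++ c y :: invw (t (inv_letter y)) /\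
    shortlex (t y) (rcons (t (inv_letter y)) (inv_letter (c y))).
  case: y => b s; rewrite [(b, s).1]/= => hb; have := dP b hb; rewrite /P hb /= => /and3P[/eqP h1 h2 h3].
  case: s => //; split; last by rewrite /t /c /= inv_letterK.
  rewrite -[(b, false)]/(inv_letter (b, true)) (hom_letter_inv psi_hom) // h1.
  by rewrite invw_cat invw_cons invwK cat_rcons.
(* The part of the image of [inv_letter y] up to and including its isolated letter begins the image
   of no other letter. *)
have iso y z w : y.1 \in S -> z.1 \in S -> z != inv_letter y ->
    psi [:: z] <> rcons (t (inv_letter y)) (c (inv_letter y)) ++ w.
  move=> hy hz nzy; have [h1 h2] := tc y hy; rewrite cV.
  by apply: (not_prefix hy hz nzy _ h2); rewrite h1 invw_rcons inv_letterK.
exists t, c; split=> // [y hy|y z hy hz yz]; first by have [] := tc y hy.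
have [ez _] := tc z hz; have [ey _] := tc (inv_letter y) hy.
have red x : x.1 \in S -> reduced (psi [:: x]) by move=> hx; apply: psi_hom.1; rewrite //= hx.
have ry := red (inv_letter y) hy; rewrite ey in ry.
have rz := red z hz; rewrite ez in rz.
(* [reduced_turn] is applied to the images of [inv_letter y] and [z]; both prefix conditions are
   instances of [iso]. *)
rewrite /turn -[c y]inv_letterK -cV; apply: (reduced_turn ry rz) => w; rewrite -?ey -?ez.
  exact: iso.
have := iso (inv_letter z) (inv_letter y) w hz hy; rewrite inv_letterK; apply.
by rewrite eq_sym.
Qed.

End NielsenReduced.

(** * Comparison of complexities over the two alphabets *)

Section Gersten.
Variables (T : finType) (S : {set T}) (Hs : seq (seq (word T))).
Hypothesis HsS : forall H, H \in Hs -> forall g, g \in H -> in_F S g.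

Lemma aut_img_in_F f : is_aut S f ->
  forall H, H \in aut_img f Hs -> forall g, g \in H -> in_F S g.
Proof.
move=> hf H /mapP[H0 hH0 ->] g /mapP[g0 hg0 ->].
exact/(aut_in_F hf)/(HsS hH0).
Qed.

Lemma seq_size_aut_le alpha m :
  is_aut [set: T] alpha -> seq_size [set: T] (aut_img alpha Hs) m ->
  exists f m', [/\ is_aut S f, m' <= m & seq_size S (aut_img f Hs) m'].
Proof.
move=> ha hm; have a_hom := aut_hom ha.
have [beta hb min] := nielsen_minimal S a_hom.
have psi_hom := is_hom_comp hb a_hom.
have neq0 y : y.1 \in S -> (alpha \o beta) [:: y] != [::].
  move=> hy; apply/eqP; rewrite -[RHS](hom1 psi_hom) /= => e.
  have [b1 _ b3 _] := hb; have [_ _ a3 _] := ha.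
  have hy1 : in_F S [:: y] by rewrite /= hy.
  have /andP[r1 F1] := b1 [:: y] isT hy1; have /andP[r0 F0] := b1 [::] isT isT.
  by have := b3 [:: y] [::] isT hy1 isT isT (a3 _ _ r1 (in_FT _) r0 (in_FT _) e).
have [t [c [cV tc tr]]] := isolated_split psi_hom neq0 min.
(* With $f = \beta^{-1}$, the map $\psi = \alpha \circ \beta$ carries $f(H)$ onto $\alpha(H)$, so
   [core_size_le] applies to this pair for each [H]. *)
have [f hf fb] := aut_inverse hb.
have step H n : H \in Hs -> core_size [set: T] (map (fun g => alpha (reduce g)) H) n ->
    exists2 n', n' <= n & core_size S (map (fun g => f (reduce g)) H) n'.
  move=> hH; have HS := HsS hH.
  apply: (core_size_le psi_hom cV tc tr).
    by move=> g /mapP[g0 hg0 ->]; apply/(aut_in_F hf)/HS.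
  move=> v; have HT g : g \in H -> in_F [set: T] g by rewrite in_FT.
  rewrite (in_sub_hom a_hom v HT).
  split=> [[u hu ->]|[_ /(in_sub_hom (aut_hom hf) _ HS)[u hu ->] ->]].
    exists (f u); first by apply/(in_sub_hom (aut_hom hf) _ HS); exists u.
    have [e _] := fb u (in_sub_in_F HS hu).
    by rewrite /= -[u in f u](reduce_id (in_sub_reduced hu)) e reduce_id ?(in_sub_reduced hu).
  exists u => //; have [e _] := fb u (in_sub_in_F HS hu).
  by rewrite /= -[u in f u](reduce_id (in_sub_reduced hu)) e reduce_id ?(in_sub_reduced hu).
exists f; suff [m' le_m' h] : exists2 m', m' <= m & seq_size S (aut_img f Hs) m' by exists m'.
case: hm => ns []; rewrite size_map => es hns ->.
elim: (Hs) ns es hns step => [|H Hs' IH] [|n ns] //=.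
  by move=> _ _ _; exists 0 => //; exists [::].
move=> [es] hns step.
have [n' le_n' hn'] := step H n (mem_head _ _) (hns 0 isT).
have [||m' le_m' [ns' [h1 h2 h3]]] := IH ns es.
- by move=> i hi; apply: (hns i.+1).
- by move=> H' n0 hH'; apply: step; rewrite inE hH' orbT.
exists (n' + m'); first exact: leq_add.
exists (n' :: ns'); split; rewrite /= ?h1 ?h3 //.
by case=> [|i] //= hi; apply: h2.
Qed.

End Gersten.

Theorem lemma9p13 (T : finType) (B' : {set T}) (Hs : seq (seq (word T))) :
  (forall H, H \in Hs -> forall g, g \in H -> in_F B' g) ->
  (gersten B' Hs <-> gersten [set: T] Hs).
Proof.
move=> hHs; split=> -[n [hn hmin]]; exists n; split.
- exact/(seq_size_setT _ hHs).
- move=> alpha ha m hm; have [f [m' [hf le_m hm']]] := seq_size_aut_le hHs ha hm.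
  exact: leq_trans (hmin f hf m' hm') le_m.
- exact/(seq_size_setT _ hHs).
- move=> f hf m hm; have [g hg gf] := aut_extend hf; apply: (hmin g hg).
  suff -> : aut_img g Hs = aut_img f Hs by apply/(seq_size_setT _ (aut_img_in_F hHs hf)).
  apply/eq_in_map => H hH; apply/eq_in_map => w hw.
  exact/gf/(hHs H hH).
Qed.
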